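(* Let $\mathcal{H}_1,\mathcal{H}_2$ be right quaternionic Hilbert spaces, $K_1 \in \mathbb{B}(\mathcal{H}_1)$, $K_2 \in \mathbb{B}(\mathcal{H}_2)$, and let $\{u_i \oplus v_i\}_{i \in I}$ be a $K_1 \oplus K_2$-frame for $\mathcal{H}_1 \oplus \mathcal{H}_2$. If $\{a_i \oplus b_i\}_{i \in I}$ is a $K_1 \oplus K_2$-dual frame to $\{u_i \oplus v_i\}_{i \in I}$, then $\{a_i\}_{i \in I}$ is a $K_1$-dual frame to $\{u_i\}_{i \in I}$ and $\{b_i\}_{i \in I}$ is a $K_2$-dual frame to $\{v_i\}_{i \in I}$.
   Context: $\mathbb{H}$ denotes the skew field of quaternions. A right quaternionic Hilbert space is a right $\mathbb{H}$-vector space with an inner product $\langle\cdot,\cdot\rangle$ valued in $\mathbb{H}$ satisfying $\langle u,v\rangle=\overline{\langle v,u\rangle}$, $\langle u,u\rangle>0$ for $u\neq 0$, additivity in the second variable and $\langle u,vq\rangle=\langle u,v\rangle q$ for $q\in\mathbb{H}$, complete for the norm $\|u\|=\sqrt{\langle u,u\rangle}$. $\mathbb{B}(\mathcal{H})$ is the set of bounded right $\mathbb{H}$-linear operators on $\mathcal{H}$; $L^*$ is the adjoint of $L$. $I$ is a countable index set. The direct sum $\mathcal{H}_1\oplus\mathcal{H}_2$ carries the inner product $\langle u_1\oplus v_1,u_2\oplus v_2\rangle=\langle u_1,u_2\rangle+\langle v_1,v_2\rangle$ and is a right quaternionic Hilbert space. $K_1\oplus K_2$ is the operator $(K_1\oplus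 K_2)(u\oplus v)=K_1u\oplus K_2v$. A sequence $\{w_i\}_{i\in I}$ in $\mathcal{H}$ is a Bessel sequence if there is $B<\infty$ with $\sum_{i\in I}|\langle w_i,u\rangle|^2\le B\|u\|^2$ for all $u\in\mathcal{H}$. For $K\in\mathbb{B}(\mathcal{H})$, it is a $K$-frame for $\mathcal{H}$ if there are $0<A\le B<\infty$ with $A\|K^*u\|^2\le\sum_{i\in I}|\langle w_i,u\rangle|^2\le B\|u\|^2$ for all $u\in\mathcal{H}$. A $K$-dual frame to a $K$-frame $\{w_i\}_{i\in I}$ is a Bessel sequence $\{z_i\}_{i\in I}$ for $\mathcal{H}$ such that $Ku=\sum_{i\in I}w_i\langle z_i,u\rangle$ for all $u\in\mathcal{H}$. *)

(* Defs.v *)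
From HB Require Import structures.
From mathcomp Require Import all_boot all_order all_algebra finmap.
From mathcomp Require Import ring lra.
From mathcomp Require Import all_classical all_reals all_analysis.
From mathcomp Require summability.

Set Implicit Arguments.
Unset Strict Implicit.
Unset Printing Implicit Defensive.
Import Order.TTheory GRing.Theory Num.Theory.
Import numFieldNormedType.Exports.
Local Open Scope classical_set_scope.
Local Open Scope ring_scope.

(* [Quat a b c d] is the quaternion a + b i + c j + d k. *)
Record quat (R : Type) := Quat { qre : R; qi : R; qj : R; qk : R }.

Section QuatRing.
Variable R : realType.
Implicit Types p q r : quat R.

Definition quat_to_prod q : R * R * R * R := (qre q, qi q, qj q, qk q).
Definition prod_to_quat (x : R * R * R * R) : quat R :=
  Quat x.1.1.1 x.1.1.2 x.1.2 x.2.

Lemma quat_to_prodK : cancel quat_to_prod prod_to_quat.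
Proof. by case. Qed.

HB.instance Definition _ := Choice.copy (quat R) (can_type quat_to_prodK).

Lemma quatP p q : qre p = qre q -> qi p = qi q -> qj p = qj q ->
  qk p = qk q -> p = q.
Proof. by case: p q => ? ? ? ? [? ? ? ?] /= -> -> -> ->. Qed.

Definition quat0 : quat R := Quat 0 0 0 0.
Definition quat1 : quat R := Quat 1 0 0 0.
Definition oppq q := Quat (- qre q) (- qi q) (- qj q) (- qk q).
Definition addq p q :=
  Quat (qre p + qre q) (qi p + qi q) (qj p + qj q) (qk p + qk q).
Definition mulq p q := Quat
  (qre p * qre q - qi p * qi q - qj p * qj q - qk p * qk q)
  (qre p * qi q + qi p * qre q + qj p * qk q - qk p * qj q)
  (qre p * qj q - qi p * qk q + qj p * qre q + qk p * qi q)
  (qre p * qk q + qi p * qj q - qj p * qi q + qk p * qre q).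
Definition conjq q := Quat (qre q) (- qi q) (- qj q) (- qk q).

Lemma addqA : associative addq.
Proof. by move=> p q r; apply: quatP => /=; ring. Qed.
Lemma addqC : commutative addq.
Proof. by move=> p q; apply: quatP => /=; ring. Qed.
Lemma add0q : left_id quat0 addq.
Proof. by move=> p; apply: quatP => /=; ring. Qed.
Lemma addNq : left_inverse quat0 oppq addq.
Proof. by move=> p; apply: quatP => /=; ring. Qed.

HB.instance Definition _ :=
  GRing.isZmodule.Build (quat R) addqA addqC add0q addNq.

Lemma mulqA : associative mulq.
Proof. by move=> p q r; apply: quatP => /=; ring. Qed.
Lemma mul1q : left_id quat1 mulq.
Proof. by move=> p; apply: quatP => /=; ring. Qed.
Lemma mulq1 : right_id quat1 mulq.
Proof. by move=> p; apply: quatP => /=; ring. Qed.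
Lemma mulqDl : left_distributive mulq addq.
Proof. by move=> p q r; apply: quatP => /=; ring. Qed.
Lemma mulqDr : right_distributive mulq addq.
Proof. by move=> p q r; apply: quatP => /=; ring. Qed.
Lemma quat1_neq0 : quat1 != 0 :> quat R.
Proof. by apply/eqP => -[] /eqP; rewrite oner_eq0. Qed.

HB.instance Definition _ := GRing.Zmodule_isNzRing.Build (quat R)
  mulqA mul1q mulq1 mulqDl mulqDr quat1_neq0.


Lemma conjqD p q : conjq (p + q) = conjq p + conjq q.
Proof. by apply: quatP => /=; ring. Qed.

Lemma conjqM p q : conjq (p * q) = conjq q * conjq p.
Proof. by apply: quatP => /=; ring. Qed.

Lemma conjqK : involutive (@conjq).
Proof. by move=> q; apply: quatP => /=; rewrite ?opprK. Qed.

Lemma qreD p q : qre (p + q) = qre p + qre q. Proof. by []. Qed.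

Lemma qre_conjq q : qre (conjq q) = qre q. Proof. by []. Qed.

Definition normsqq q : R := qre q ^+ 2 + qi q ^+ 2 + qj q ^+ 2 + qk q ^+ 2.

Definition normq q : R := Num.sqrt (normsqq q).

Lemma normsqq_ge0 q : 0 <= normsqq q.
Proof. by rewrite /normsqq !addr_ge0 ?sqr_ge0. Qed.

Lemma ler_normqD p q : normq (p + q) <= normq p + normq q.
Proof.
have [pge qge] : 0 <= normq p /\ 0 <= normq q by rewrite !sqrtr_ge0.
rewrite -(ler_pXn2r (ltn0Sn 1)) ?nnegrE ?addr_ge0 ?sqrtr_ge0//.
rewrite sqrrD !sqr_sqrtr ?normsqq_ge0//.
pose d := qre p * qre q + qi p * qi q + qj p * qj q + qk p * qk q.
have -> : normsqq (p + q) = normsqq p + normsqq q + 2 * d.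
  by rewrite /normsqq /d /=; ring.
suff le_d : d <= normq p * normq q by lra.
apply: (le_trans (ler_norm _)); rewrite -(ler_pXn2r (ltn0Sn 1)) ?nnegrE//.
  rewrite real_normK ?num_real// exprMn !sqr_sqrtr ?normsqq_ge0// -subr_ge0.
  have -> : normsqq p * normsqq q - d ^+ 2 =
    (qre p * qi q - qi p * qre q) ^+ 2 + (qre p * qj q - qj p * qre q) ^+ 2 +
    (qre p * qk q - qk p * qre q) ^+ 2 + (qi p * qj q - qj p * qi q) ^+ 2 +
    (qi p * qk q - qk p * qi q) ^+ 2 + (qj p * qk q - qk p * qj q) ^+ 2.
    by rewrite /normsqq /d; ring.
  by rewrite !addr_ge0 ?sqr_ge0.
by rewrite mulr_ge0.
Qed.

Lemma normq0_eq0 q : normq q = 0 -> q = 0.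
Proof.
move=> /eqP; rewrite sqrtr_eq0 => le0.
have /eqP := le_anti (introT andP (conj le0 (normsqq_ge0 q))).
rewrite /normsqq !paddr_eq0 ?addr_ge0 ?sqr_ge0// !sqrf_eq0.
by move=> /andP[/andP[/andP[/eqP a0 /eqP b0] /eqP c0] /eqP d0]; apply: quatP.
Qed.

Lemma quat_mulrn q n :
  q *+ n = Quat (qre q *+ n) (qi q *+ n) (qj q *+ n) (qk q *+ n).
Proof.
elim: n => [|n IH]; first by rewrite !mulr0n.
by rewrite !mulrS IH.
Qed.

Lemma normqMn q n : normq (q *+ n) = normq q *+ n.
Proof.
have e : normsqq (q *+ n) = n%:R ^+ 2 * normsqq q.
  rewrite quat_mulrn /normsqq /= -[qre q *+ n]mulr_natl -[qi q *+ n]mulr_natl.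
  by rewrite -[qj q *+ n]mulr_natl -[qk q *+ n]mulr_natl !exprMn -!mulrDr.
by rewrite /normq e sqrtrM ?sqr_ge0// sqrtr_sqr ger0_norm// mulr_natl.
Qed.

Lemma normqN q : normq (- q) = normq q.
Proof. by rewrite /normq /normsqq /= !sqrrN. Qed.

HB.instance Definition _ := Num.Zmodule_isNormed.Build R (quat R)
  ler_normqD normq0_eq0 normqMn normqN.

End QuatRing.

(* The library's modules are left modules. Going through left modules over the
   converse ring of the quaternions would conflict with the library's joins of
   topological structures and modules over a numeric scalar ring. *)
HB.mixin Record Zmodule_isRightQuatModule (R : realType) V
    of GRing.Zmodule V := {
  rscale : V -> quat R -> V ;
  rscaleA : forall v p q, rscale (rscale v p) q = rscale v (p * q) ;
  rscale1 : forall v, rscale v 1 = v ;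
  rscaleDl : forall u v q, rscale (u + v) q = rscale u q + rscale v q ;
  rscaleDr : forall v p q, rscale v (p + q) = rscale v p + rscale v q
}.

#[short(type="rightQuatModType")]
HB.structure Definition RightQuatModule (R : realType) :=
  {V of GRing.Zmodule V & Zmodule_isRightQuatModule R V}.

Notation "v *q: q" := (rscale v q) (at level 40, left associativity).

HB.mixin Record RightQuatModule_isPreHilbert (R : realType) V
    of RightQuatModule R V := {
  inner : V -> V -> quat R ;
  inner_conj : forall u v, inner u v = conjq (inner v u) ;
  (* [inner u u] is real by [inner_conj]. *)
  inner_gt0 : forall u, u != 0 -> 0 < qre (inner u u) ;
  innerDr : forall u v w, inner u (v + w) = inner u v + inner u w ;
  innerZr : forall u v q, inner u (v *q: q) = inner u v * q
}.

#[short(type="quatPreHilbertType")]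
HB.structure Definition QuatPreHilbert (R : realType) :=
  {V of RightQuatModule R V & RightQuatModule_isPreHilbert R V}.

(* The completeness field is the library's [Uniform_isComplete]; the structure
   [Complete] itself cannot be joined here, since the hierarchy below
   [CompleteNormedModule] is already closed. *)
HB.mixin Record PreHilbert_isHilbert (R : realType) V of QuatPreHilbert R V
    & PseudoMetricNormedZmod R V := {
  norm_inner : forall u : V, `|u| = Num.sqrt (qre (inner u u)) ;
  quat_cauchy_cvg : forall F : set_system V,
    ProperFilter F -> cauchy F -> cvg F
}.

#[short(type="quatHilbertType")]
HB.structure Definition QuatHilbert (R : realType) :=
  {V of QuatPreHilbert R V & PseudoMetricNormedZmod R V
   & PreHilbert_isHilbert R V}.

Section PreHilbertTheory.
Variables (R : realType) (H : quatPreHilbertType R).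
Implicit Types u v w : H.

Definition sqnorm u : R := qre (inner u u).

Lemma inner0r u : inner u 0 = 0.
Proof. by apply: (addrI (inner u 0)); rewrite -innerDr !addr0. Qed.

Lemma innerDl u v w : inner (u + v) w = inner u w + inner v w.
Proof. by rewrite inner_conj innerDr conjqD -!inner_conj. Qed.

Lemma innerZl u v q : inner (u *q: q) v = conjq q * inner u v.
Proof. by rewrite inner_conj innerZr conjqM -inner_conj. Qed.

Lemma sqnorm_ge0 u : 0 <= sqnorm u.
Proof.
have [->|/inner_gt0/ltW//] := eqVneq u 0.
by rewrite /sqnorm inner0r.
Qed.

Definition qscal (t : R) : quat R := Quat t 0 0 0.

Lemma sqnormDZ u v t : sqnorm (u + v *q: qscal t) =
  sqnorm u + 2 * t * qre (inner u v) + t ^+ 2 * sqnorm v.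
Proof.
rewrite /sqnorm !(innerDl, innerDr, innerZl, innerZr) (inner_conj v u).
by rewrite /=; ring.
Qed.

Lemma qre_inner_le u v :
  qre (inner u v) <= Num.sqrt (sqnorm u) * Num.sqrt (sqnorm v).
Proof.
apply: (le_trans (ler_norm _)).
rewrite -(ler_pXn2r (ltn0Sn 1)) ?nnegrE ?mulr_ge0 ?sqrtr_ge0//.
rewrite real_normK ?num_real// exprMn !sqr_sqrtr ?sqnorm_ge0//.
have [v0|v0] := eqVneq v 0.
  rewrite v0 inner0r expr0n mulr_ge0 ?sqnorm_ge0//.
have s_gt0 : 0 < sqnorm v by exact: inner_gt0.
have := sqnorm_ge0 (u + v *q: qscal (- (qre (inner u v) / sqnorm v))).
rewrite sqnormDZ; set a := sqnorm u; set s := sqnorm v; set b := qre _.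
have -> : a + 2 * - (b / s) * b + (- (b / s)) ^+ 2 * s = a - b ^+ 2 / s.
  by field; exact: lt0r_neq0.
by rewrite subr_ge0 ler_pdivrMr.
Qed.

Lemma sqrt_sqnormD u v :
  Num.sqrt (sqnorm (u + v)) <= Num.sqrt (sqnorm u) + Num.sqrt (sqnorm v).
Proof.
rewrite -(ler_pXn2r (ltn0Sn 1)) ?nnegrE ?addr_ge0 ?sqrtr_ge0//.
rewrite sqrrD !sqr_sqrtr ?sqnorm_ge0//.
have -> : sqnorm (u + v) = sqnorm u + 2 * qre (inner u v) + sqnorm v.
  by rewrite /sqnorm !(innerDl, innerDr) (inner_conj v u) /=; ring.
by have := qre_inner_le u v; lra.
Qed.

Lemma sqrt_sqnorm_eq0 u : Num.sqrt (sqnorm u) = 0 -> u = 0.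
Proof.
move=> /eqP; rewrite sqrtr_eq0 => le0.
have [//|/inner_gt0] := eqVneq u 0.
by rewrite ltNge [X in ~~ X]le0.
Qed.

Lemma innerNr u v : inner u (- v) = - inner u v.
Proof. by apply: (addrI (inner u v)); rewrite -innerDr !subrr inner0r. Qed.

Lemma innerNl u v : inner (- u) v = - inner u v.
Proof. by rewrite inner_conj innerNr inner_conj; apply: quatP => /=; rewrite ?opprK. Qed.

Lemma sqrt_sqnormN u : Num.sqrt (sqnorm (- u)) = Num.sqrt (sqnorm u).
Proof. by rewrite /sqnorm innerNl innerNr opprK. Qed.

Lemma sqrt_sqnormMn u n :
  Num.sqrt (sqnorm (u *+ n)) = Num.sqrt (sqnorm u) *+ n.
Proof.
have inMr v w k : inner v (w *+ k) = inner v w *+ k.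
  by elim: k => [|k IH]; rewrite ?mulr0n ?inner0r// !mulrS innerDr IH.
have inMl v w k : inner (v *+ k) w = inner v w *+ k.
  elim: k => [|k IH]; last by rewrite !mulrS innerDl IH.
  by rewrite !mulr0n inner_conj inner0r; apply: quatP; rewrite /= ?oppr0.
have -> : sqnorm (u *+ n) = n%:R ^+ 2 * sqnorm u.
  by rewrite /sqnorm inMr inMl !quat_mulrn /= -mulrnA -[LHS]mulr_natl natrM expr2.
by rewrite sqrtrM ?sqr_ge0// sqrtr_sqr ger0_norm// mulr_natl.
Qed.

End PreHilbertTheory.

(* The product type already carries the maximum norm, hence the alias. *)
Definition qdsum (T1 T2 : Type) : Type := (T1 * T2)%type.

Definition qpair (T1 T2 : Type) (u : T1) (v : T2) : qdsum T1 T2 := (u, v).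

Section DirectSumPre.
Variables (R : realType) (H1 H2 : quatPreHilbertType R).
Local Notation D := (qdsum H1 H2).

HB.instance Definition _ := GRing.Zmodule.copy D (H1 * H2)%type.

Definition drscale (x : D) (q : quat R) : D := (x.1 *q: q, x.2 *q: q).

Lemma drscaleA x p q : drscale (drscale x p) q = drscale x (p * q).
Proof. by rewrite /drscale /= !rscaleA. Qed.

Lemma drscale1 x : drscale x 1 = x.
Proof. by case: x => u v; rewrite /drscale /= !rscale1. Qed.

Lemma drscaleDl x y q : drscale (x + y) q = drscale x q + drscale y q.
Proof. by rewrite /drscale /= !rscaleDl. Qed.

Lemma drscaleDr x p q : drscale x (p + q) = drscale x p + drscale x q.
Proof. by rewrite /drscale /= !rscaleDr. Qed.

HB.instance Definition _ := Zmodule_isRightQuatModule.Build R D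
  drscaleA drscale1 drscaleDl drscaleDr.

Definition dinner (x y : D) : quat R := inner x.1 y.1 + inner x.2 y.2.

Lemma dinner_conj x y : dinner x y = conjq (dinner y x).
Proof. by rewrite /dinner conjqD -!inner_conj. Qed.

Lemma dinner_gt0 x : x != 0 -> 0 < qre (dinner x x).
Proof.
case: x => u v x0; rewrite /dinner qreD /=.
have [u0|u0] := eqVneq u 0.
  have v0 : v != 0 by apply: contraNneq x0 => v0; rewrite u0 v0.
  by rewrite ltr_wpDl ?inner_gt0//; exact: sqnorm_ge0.
by rewrite ltr_pwDl ?inner_gt0//; exact: sqnorm_ge0.
Qed.

Lemma dinnerDr x y z : dinner x (y + z) = dinner x y + dinner x z.
Proof. by rewrite /dinner !innerDr addrACA. Qed.

Lemma dinnerZr x y q : dinner x (y *q: q) = dinner x y * q.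
Proof. by rewrite /dinner !innerZr mulrDl. Qed.

HB.instance Definition _ := RightQuatModule_isPreHilbert.Build R D
  dinner_conj dinner_gt0 dinnerDr dinnerZr.

HB.instance Definition _ := Num.Zmodule_isNormed.Build R D
  (@sqrt_sqnormD R D) (@sqrt_sqnorm_eq0 R D) (@sqrt_sqnormMn R D)
  (@sqrt_sqnormN R D).
HB.instance Definition _ := PseudoMetric.copy D (pseudoMetric_normed D).
HB.instance Definition _ := isPointed.Build D 0.
HB.instance Definition _ := NormedZmod_PseudoMetric_eq.Build R D erefl.

End DirectSumPre.

Section DirectSum.
Variables (R : realType) (H1 H2 : quatHilbertType R).
Local Notation D := (qdsum H1 H2).
Implicit Types x : D.

Lemma norm_qdsum x : `|x| = Num.sqrt (`|x.1| ^+ 2 + `|x.2| ^+ 2).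
Proof. by rewrite !norm_inner !sqr_sqrtr// ; exact: sqnorm_ge0. Qed.

Lemma norm_qdsum_fst x : `|x.1| <= `|x|.
Proof.
rewrite norm_qdsum -[leLHS]ger0_norm// -sqrtr_sqr ler_wsqrtr//.
by rewrite lerDl sqr_ge0.
Qed.

Lemma norm_qdsum_snd x : `|x.2| <= `|x|.
Proof.
rewrite norm_qdsum -[leLHS]ger0_norm// -sqrtr_sqr ler_wsqrtr//.
by rewrite lerDr sqr_ge0.
Qed.

Lemma norm_qdsum_le x : `|x| <= `|x.1| + `|x.2|.
Proof.
rewrite norm_qdsum -[leRHS]ger0_norm ?addr_ge0// -sqrtr_sqr ler_wsqrtr//.
by rewrite sqrrD addrAC lerDl mulrn_wge0// mulr_ge0.
Qed.

Lemma qdsum_complete (F : set_system D) :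
  ProperFilter F -> cauchy F -> cvg F.
Proof.
move=> FF /cauchyP Fc.
have c1 : cauchy (fst @ F).
  apply: cauchy_exP => e e0; have [x Fx] := Fc e e0.
  exists x.1; apply: (@filterS _ F _ (ball x e)) Fx => y.
  rewrite -!ball_normE /ball_ /=; apply: le_lt_trans.
  exact: (norm_qdsum_fst (x - y)).
have c2 : cauchy (snd @ F).
  apply: cauchy_exP => e e0; have [x Fx] := Fc e e0.
  exists x.2; apply: (@filterS _ F _ (ball x e)) Fx => y.
  rewrite -!ball_normE /ball_ /=; apply: le_lt_trans.
  exact: (norm_qdsum_snd (x - y)).
have /cvg_ex[l1 /cvgrPdist_lt F1] : cvg (fst @ F) by exact: quat_cauchy_cvg c1.
have /cvg_ex[l2 /cvgrPdist_lt F2] : cvg (snd @ F) by exact: quat_cauchy_cvg c2.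
apply/cvg_ex; exists (qpair l1 l2); apply/cvgrPdist_lt => e e0.
have e20 : 0 < e / 2 by rewrite divr_gt0.
near=> x; apply: (le_lt_trans (norm_qdsum_le _)); rewrite [ltRHS]splitr ltrD//=.
- by near: x; exact: F1.
- by near: x; exact: F2.
Unshelve. all: by end_near. Qed.

HB.instance Definition _ :=
  PreHilbert_isHilbert.Build R D (fun=> erefl) qdsum_complete.

End DirectSum.


Definition right_linear (R : realType) (H H' : rightQuatModType R)
    (f : H -> H') : Prop :=
  (forall u v, f (u + v) = f u + f v) /\ (forall u q, f (u *q: q) = f u *q: q).

Definition bounded_map (R : realType) (H H' : normedZmodType R) (f : H -> H')
  : Prop := exists M : R, forall u, `|f u| <= M * `|u|.

Record bounded_op (R : realType) (H : quatHilbertType R) := BoundedOp {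
  op_fun :> H -> H ;
  op_linear : right_linear op_fun ;
  op_bounded : bounded_map op_fun
}.

Section DirectSumOp.
Variables (R : realType) (H1 H2 : quatHilbertType R).
Variables (K1 : bounded_op H1) (K2 : bounded_op H2).

Definition dsum_fun (x : qdsum H1 H2) : qdsum H1 H2 :=
  qpair (K1 x.1) (K2 x.2).

Lemma dsum_fun_linear : right_linear dsum_fun.
Proof.
have [[D1 Z1] [D2 Z2]] := (op_linear K1, op_linear K2).
split=> [x y | x q]; first by rewrite /dsum_fun /= D1 D2.
by rewrite /dsum_fun /= Z1 Z2.
Qed.

Lemma dsum_fun_bounded : bounded_map dsum_fun.
Proof.
have [[M1 b1] [M2 b2]] := (op_bounded K1, op_bounded K2).
exists (`|M1| + `|M2|) => x; apply: (le_trans (norm_qdsum_le _)).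
rewrite mulrDl lerD//=.
- apply: (le_trans (b1 _)); apply: (le_trans (ler_wpM2r _ (ler_norm M1))) => //.
  by rewrite ler_wpM2l// norm_qdsum_fst.
- apply: (le_trans (b2 _)); apply: (le_trans (ler_wpM2r _ (ler_norm M2))) => //.
  by rewrite ler_wpM2l// norm_qdsum_snd.
Qed.

Definition dsum_op : bounded_op (qdsum H1 H2) :=
  BoundedOp dsum_fun_linear dsum_fun_bounded.

End DirectSumOp.

Section Riesz.
Variables (R : realType) (H : quatHilbertType R).
Implicit Types u v w : H.

Lemma sqr_norm_inner u : `|u| ^+ 2 = sqnorm u.
Proof. by rewrite norm_inner sqr_sqrtr//; exact: sqnorm_ge0. Qed.

Lemma qre_inner_le_norm u v : `|qre (inner u v)| <= `|u| * `|v|.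
Proof.
rewrite ler_norml !norm_inner; apply/andP; split; last exact: qre_inner_le.
by have := qre_inner_le (- u) v; rewrite sqrt_sqnormN innerNl /=; lra.
Qed.

Lemma quat_re_inj (p q : quat R) :
  (forall r, qre (p * r) = qre (q * r)) -> p = q.
Proof.
move=> e; have := (e (Quat 1 0 0 0), e (Quat 0 1 0 0), e (Quat 0 0 1 0),
  e (Quat 0 0 0 1)); case: p q {e} => a b c d [a' b' c' d'] /=.
by move=> [[[? ?] ?] ?]; apply: quatP => /=; lra.
Qed.

Lemma riesz (f : H -> quat R) :
  (forall u v, f (u + v) = f u + f v) ->
  (forall u q, f (u *q: q) = f u * q) ->
  (exists M : R, forall u, qre (f u) <= M * `|u|) ->
  exists w, forall v, inner w v = f v.
Proof.
move=> fD fZ [M fM].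
pose g v := 2 * qre (f v) - `|v| ^+ 2.
pose s := sup (range g).
have gub v : g v <= s.
  apply: ub_le_sup; last by exists v.
  exists (M ^+ 2) => _ [x _ <-]; have := fM x; rewrite /g.
  by have := sqr_ge0 (`|x| - M); rewrite sqrrB; lra.
pose F : set_system H :=
  filter_from [set e : R | 0 < e] (fun e => [set v | s - e < g v]).
have sadh (e : R) : 0 < e -> exists v, s - e < g v.
  move=> e0; have [|_ [v _ <-] lt_v] := @sup_adherent R (range g) e e0.
    split; first by exists (g 0), 0.
    by exists s => _ [x _ <-]; exact: gub.
  by exists v.
have FF : ProperFilter F.
  apply: filter_from_proper => [|e /sadh[v ?]]; last by exists v.
  apply: filter_from_filter => [|i j i0 j0]; first by exists 1 => /=.
  exists (Num.min i j); first by rewrite /= lt_min i0.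
  have [mi mj] : Num.min i j <= i /\ Num.min i j <= j.
    by rewrite !ge_min !lexx orbT.
  by move=> v /= sv; split; apply: le_lt_trans sv; rewrite lerD2l lerN2.
have Fc : cauchy F.
  apply: cauchy_exP => e e0; have e8 : 0 < e ^+ 2 / 8.
    by rewrite divr_gt0// exprn_gt0.
  have [v sv] := sadh _ e8; exists v; exists (e ^+ 2 / 8) => // w /= sw.
  rewrite -ball_normE /ball_ /= -(ltr_pXn2r (ltn0Sn 1)) ?nnegrE ?(ltW e0)//.
  have := gub ((v + w) *q: qscal 2^-1); move: sv sw.
  rewrite /g fZ fD !sqr_norm_inner.
  rewrite /sqnorm !(innerDl, innerDr, innerZl, innerZr, innerNl, innerNr) /=.
  by rewrite (inner_conj w v) /=; lra.
have /cvg_ex[w Fw] : cvg F by exact: quat_cauchy_cvg Fc.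
exists w.
suff re_eq (h : H) : qre (inner w h) = qre (f h).
  by move=> v; apply: quat_re_inj => r; rewrite -innerZr -fZ.
have [->|h0] := eqVneq h 0.
  have -> : f 0 = 0 by apply: (addrI (f 0)); rewrite -fD !addr0.
  by rewrite inner0r.
have n0 : 0 < `|h| by rewrite normr_gt0.
suff le_e (e : R) : 0 < e -> `|qre (f h) - qre (inner w h)| <= e.
  apply/esym/eqP; rewrite -subr_eq0 -normr_le0.
  by apply/ler_addgt0Pr => e e0; rewrite add0r le_e.
move=> e0.
pose d := e / (2 * `|h|).
have d0 : 0 < d by rewrite divr_gt0// mulr_gt0.
have dE : 2 * (d * `|h|) = e by rewrite /d; field; rewrite gt_eqF.
have F2 : F [set v | s - d ^+ 2 < g v] by exists (d ^+ 2) => //=; exact: exprn_gt0.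
have [v [/= vw gv]] : exists v, `|w - v| < d /\ s - d ^+ 2 < g v.
  have FI : F ([set v | `|w - v| < d] `&` [set v | s - d ^+ 2 < g v]).
    apply: filterI => //; have : F (ball w d) by apply: Fw; exact: nbhsx_ballx.
    by rewrite -ball_normE.
  by have [v [? ?]] := filter_ex FI; exists v.
pose c := qre (f h) - qre (inner v h).
have dh0 : 0 <= d * `|h| by exact: mulr_ge0 (ltW d0) (normr_ge0 h).
have cd : `|c| <= d * `|h|.
  rewrite -(ler_pXn2r (ltn0Sn 1)) ?nnegrE//.
  rewrite real_normK ?num_real// exprMn -ler_pdivrMr ?exprn_gt0//.
  have := gub (v + h *q: qscal (c / `|h| ^+ 2)); move: gv.
  rewrite /g fD fZ !sqr_norm_inner sqnormDZ -sqr_norm_inner /=.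
  rewrite -!sqr_norm_inner.
  have -> : (c / `|h| ^+ 2) ^+ 2 * `|h| ^+ 2 = c ^+ 2 / `|h| ^+ 2.
    by field; rewrite gt_eqF.
  have -> : 2 * (c / `|h| ^+ 2) * qre (inner v h) =
      2 * (c / `|h| ^+ 2) * qre (f h) - 2 * (c ^+ 2 / `|h| ^+ 2).
    by rewrite /c; field; rewrite gt_eqF.
  by rewrite !mulr0 !subr0; lra.
have dw : `|qre (inner (w - v) h)| <= d * `|h|.
  by apply: (le_trans (qre_inner_le_norm _ _)); rewrite ler_wpM2r// ltW.
rewrite -dE mulr_natl mulr2n.
have -> : qre (f h) - qre (inner w h) = c - qre (inner (w - v) h).
  by rewrite innerDl innerNl /c /=; ring.
by apply: (le_trans (ler_normB _ _)); rewrite lerD.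
Qed.

End Riesz.

(* [adjoint K u] is the vector representing the bounded functional
   [v |-> inner u (K v)]. *)
Definition adjoint (R : realType) (H : quatHilbertType R) (K : bounded_op H)
    (u : H) : H :=
  xget 0 [set w : H | forall v, inner w v = inner u (K v)].

Lemma inner_adjoint (R : realType) (H : quatHilbertType R) (K : bounded_op H)
  (u v : H) : inner (adjoint K u) v = inner u (K v).
Proof.
suff [w] : exists w : H, forall v, inner w v = inner u (K v).
  by rewrite /adjoint; case: xgetP => [x _ ->// | /(_ w)].
have [KD KZ] := op_linear K; have [M KM] := op_bounded K.
apply: (@riesz R H (fun v => inner u (K v))).
- by move=> x y; rewrite KD innerDr.
- by move=> x q; rewrite KZ innerZr.
exists (`|u| * M) => x; apply: (le_trans (ler_norm _)).
by apply: (le_trans (qre_inner_le_norm _ _)); rewrite -mulrA ler_wpM2l.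
Qed.

Section Frames.
Variables (R : realType) (H : quatHilbertType R) (I : countType).
Implicit Types (K : bounded_op H) (w z : I -> H).

Definition bessel w : Prop := exists B : R, forall u : H,
  (\esum_(i in [set: I]) (`|inner (w i) u| ^+ 2)%:E <= (B * `|u| ^+ 2)%:E)%E.

Definition K_frame K w : Prop := exists A B : R,
  [/\ 0 < A, A <= B & forall u : H,
    ((A * `|adjoint K u| ^+ 2)%:E
       <= \esum_(i in [set: I]) (`|inner (w i) u| ^+ 2)%:E
       <= (B * `|u| ^+ 2)%:E)%E].

(* The series over [I] is the limit of the net of its finite partial sums. *)
Definition K_dual_frame K w z : Prop :=
  [/\ K_frame K w, bessel z & forall u : H,
    summability.partial_sum (fun i => w i *q: inner (z i) u)
      @ summability.totally --> K u].

End Frames.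

(* Main.v *)
Require Import Defs.
From mathcomp Require Import all_boot all_order all_algebra.
From mathcomp Require Import all_classical all_reals all_analysis.

(** A summand [H1] of [H1 (+) H2] sits in the direct sum through an isometry,
    [x |-> (x, 0)], whose adjoint is the coordinate projection, and [K1] is the
    compression of [K1 (+) K2] along that isometry; likewise for [H2].  So the
    theorem is twice the following fact: if [J : H -> D] is an isometry with
    adjoint [P], then projecting by [P] turns a [K]-frame of [D] and a
    [K]-dual of it into a [P K J]-frame of [H] and a [P K J]-dual of that.

    Everything is read off on vectors [J x].  The coefficients of [x] against
    the projected family are those of [J x] against the original one, since
    [<P w, x> = <w, J x>], and [J x] has the norm of [x]: so upper bounds pass
    to [H] with the same constant ([bessel_proj]).  The lower bound also passes,
    because [(P K J)^* = P K^* J] and [P] does not increase norms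
    ([K_frame_proj]).  Applying the continuous, right linear map [P] to the
    expansion of [K (J x)] termwise gives the expansion of [P K J x]
    ([K_dual_frame_proj]). *)

Set Implicit Arguments.
Unset Strict Implicit.
Unset Printing Implicit Defensive.
Import Order.TTheory GRing.Theory Num.Theory.
Import numFieldNormedType.Exports.
Local Open Scope classical_set_scope.
Local Open Scope ring_scope.

Lemma inner_ext (R : realType) (H : quatPreHilbertType R) (x y : H) :
  (forall z, inner z x = inner z y) -> x = y.
Proof.
move=> xy; apply/eqP; rewrite -subr_eq0; apply/negPn/negP => /inner_gt0.
by rewrite innerDr innerNr xy subrr ltxx.
Qed.

Lemma inner0l (R : realType) (H : quatPreHilbertType R) (x : H) :
  inner 0 x = 0.
Proof. by rewrite inner_conj inner0r; apply: quatP; rewrite /= ?oppr0. Qed.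

Section Compression.
Variables (R : realType) (D H : quatHilbertType R) (J : H -> D) (P : D -> H).
Hypothesis innerJl : forall x y, inner (J x) y = inner x (P y).
Hypothesis JK : cancel J P.

Lemma inner_projl y x : inner (P y) x = inner y (J x).
Proof. by rewrite inner_conj -innerJl -inner_conj. Qed.

Lemma norm_isometry x : `|J x| = `|x|.
Proof. by rewrite !norm_inner innerJl JK. Qed.

Lemma projD : {morph P : y z / y + z}.
Proof. by move=> y z; apply: inner_ext => x; rewrite innerDr -!innerJl innerDr. Qed.

Lemma proj0 : P 0 = 0.
Proof. by apply: inner_ext => x; rewrite -innerJl !inner0r. Qed.

Lemma projB y z : P (y - z) = P y - P z.
Proof.
by apply: inner_ext => x; rewrite innerDr innerNr -!innerJl innerDr innerNr.
Qed.

Lemma projZ y q : P (y *q: q) = P y *q: q.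
Proof. by apply: inner_ext => x; rewrite innerZr -!innerJl innerZr. Qed.

(** Cauchy-Schwarz in [|P y|^2 = <J (P y), y>], as [J] is isometric. *)
Lemma norm_proj_le y : `|P y| <= `|y|.
Proof.
have [->|Py0] := eqVneq (P y) 0; first by rewrite normr0 normr_ge0.
have Pgt0 : 0 < `|P y| by rewrite normr_gt0.
rewrite -(ler_pM2l Pgt0) -expr2 sqr_norm_inner /sqnorm -innerJl.
apply: le_trans (ler_norm _) _.
by rewrite -(norm_isometry (P y)) qre_inner_le_norm.
Qed.

Lemma cvg_proj (T : Type) (F : set_system T) (f : T -> D) (l : D) :
  Filter F -> f @ F --> l -> P \o f @ F --> P l.
Proof.
move=> FF /cvgrPdist_lt fl; apply/cvgrPdist_lt => e /fl.
apply: filterS => t /=; apply: le_lt_trans.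
by rewrite -projB norm_proj_le.
Qed.

Variables (I : countType) (K : bounded_op D) (K' : bounded_op H).
Hypothesis compr : forall x, K' x = P (K (J x)).

Lemma adjoint_compression x : adjoint K' x = P (adjoint K (J x)).
Proof.
apply: inner_ext => y; rewrite [LHS]inner_conj [RHS]inner_conj.
by rewrite inner_adjoint inner_projl inner_adjoint innerJl compr.
Qed.

Lemma esum_proj (w : I -> D) x :
  (\esum_(i in [set: I]) (`|inner (P (w i)) x| ^+ 2)%:E
   = \esum_(i in [set: I]) (`|inner (w i) (J x)| ^+ 2)%:E)%E.
Proof. by apply: eq_esum => i _; rewrite inner_projl. Qed.

Lemma bessel_proj (w : I -> D) : bessel w -> bessel (P \o w).
Proof.
by move=> [B wB]; exists B => x /=; rewrite esum_proj -norm_isometry.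
Qed.

(** The lower bound survives with the same constant, by
    [adjoint_compression] and [norm_proj_le]. *)
Lemma K_frame_proj (w : I -> D) : K_frame K w -> K_frame K' (P \o w).
Proof.
move=> [A [B [A0 AB wAB]]]; exists A, B; split=> // x /=.
rewrite esum_proj -(norm_isometry x); have /andP[wA ->] := wAB (J x).
rewrite andbT; apply: le_trans wA.
by rewrite lee_fin ler_pM2l// lerXn2r ?nnegrE// adjoint_compression norm_proj_le.
Qed.

Lemma K_dual_frame_proj (w z : I -> D) :
  K_dual_frame K w z -> K_dual_frame K' (P \o w) (P \o z).
Proof.
move=> [Kw Bz wz]; split; [exact: K_frame_proj | exact: bessel_proj|move=> x].
rewrite compr; set S := summability.partial_sum _.
suff -> : S = P \o summability.partial_sum (fun i => w i *q: inner (z i) (J x)).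
  apply: cvg_proj (wz (J x)).
  exact: (@filter_filter _ _ summability.totally_filter).
apply/funext => A; rewrite /S /summability.partial_sum /=.
rewrite (big_morph P projD proj0).
by apply: eq_bigr => i _ /=; rewrite projZ inner_projl.
Qed.

End Compression.

Theorem theorem15 (R : realType) (H1 H2 : quatHilbertType R)
    (K1 : bounded_op H1) (K2 : bounded_op H2) (I : countType)
    (u : I -> H1) (v : I -> H2)
    (hframe : K_frame (dsum_op K1 K2) (fun i => qpair (u i) (v i)))
    (a : I -> H1) (b : I -> H2)
    (hdual : K_dual_frame (dsum_op K1 K2) (fun i => qpair (u i) (v i))
               (fun i => qpair (a i) (b i))) :
  K_dual_frame K1 u a /\ K_dual_frame K2 v b.
Proof.
split.
- apply: (@K_dual_frame_proj R (qdsum H1 H2) H1 (fun x => qpair x 0) fst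
    _ _ I (dsum_op K1 K2) K1 _ _ _ hdual) => //.
  by move=> x y; rewrite /inner /= /dinner /= inner0l addr0.
- apply: (@K_dual_frame_proj R (qdsum H1 H2) H2 (fun x => qpair 0 x) snd
    _ _ I (dsum_op K1 K2) K2 _ _ _ hdual) => //.
  by move=> x y; rewrite /inner /= /dinner /= inner0l add0r.
Qed.
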